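(* Let $m, q, r$ be arbitrary rational numbers. Let $(a_1,a_2,a_3,a_4)$ and $(b_1,b_2,b_3,b_4)$ be the two quadruples defined in either of the following two ways: (i) \[ \begin{aligned} a_1 & = 16m^2(m^4-1)^2\bigl((5m^4-2m^2+1)q^2-2(m^4-6m^2+1)qr+(m^4-2m^2+5)r^2\bigr)^2,\\ a_2 & = 16m^2(m^4-1)^2\bigl((5m^4-2m^2+1)q^2-(m^4-2m^2+5)r^2\bigr)^2,\\ a_3 & = 16m^2(m^4-1)^2\bigl((7m^4-2m^2-1)q^2-(2m^4-12m^2+2)qr-(m^4+2m^2-7)r^2\bigr)^2,\\ a_4 & = (m^2-1)^2\bigl((3m^8+40m^6-26m^4-1)q^2+2(m^4-6m^2+1)^2qr-(m^8+26m^4-40m^2-3)r^2\bigr)^2,\\ b_1 & = 0,\\ b_2 & = -4m^2\bigl((m^4+6m^2-3)q+(m^4-2m^2+5)r\bigr)\bigl((3m^4-6m^2-1)q-(m^4-2m^2+5)r\bigr)\\ &\quad\times\bigl((5m^4-2m^2+1)q-(3m^4-6m^2-1)r\bigr)\bigl((5m^4-2m^2+1)q+(m^4+6m^2-3)r\bigr),\\ b_3 & = -128m^2(m^4-1)^3(q^2-r^2)(3m^2q-m^2r-q+3r)(m^2q+r),\\ b_4 & = 16(m^2+1)^2(m^2-1)^3(m^2q^2-r^2)\bigl((m^4+6m^3-2m-1)q-(m^4+2m^3-6m-1)r\bigr)\\ &\quad\times\bigl((m^4-6m^3+2m-1)q-(m^4-2m^3+6m-1)r\bigr); \end{aligned}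 \] (ii) \[ \begin{aligned} a_1 & = 16m^2(m^4-1)^2\bigl((m^6-2m^4+5m^2)q^2+(2m^5-12m^3+2m)qr+(5m^4-2m^2+1)r^2\bigr)^2,\\ a_2 & = 16m^2(m^4-1)^2\bigl((m^6-2m^4+5m^2)q^2-(5m^4-2m^2+1)r^2\bigr)^2,\\ a_3 & = (m^2-1)^2\bigl((m^{10}+26m^6-40m^4-3m^2)q^2+(2m^9-24m^7+76m^5-24m^3+2m)qr\\ &\quad-(3m^8+40m^6-26m^4-1)r^2\bigr)^2,\\ a_4 & = 16m^2(m^4-1)^2\bigl((m^6+2m^4-7m^2)q^2-(2m^5-12m^3+2m)qr-(7m^4-2m^2-1)r^2\bigr)^2,\\ b_1 & = 0,\\ b_2 & = -4m^2\bigl((m^5+6m^3-3m)q-(5m^4-2m^2+1)r\bigr)\bigl((3m^5-6m^3-m)q+(5m^4-2m^2+1)r\bigr)\\ &\quad\times\bigl((m^5-2m^3+5m)q+(3m^4-6m^2-1)r\bigr)\bigl((m^5-2m^3+5m)q-(m^4+6m^2-3)r\bigr),\\ b_3 & = -16m^2(m^2+1)^2(m^2-1)^3(q^2-r^2)\bigl((m^5-2m^4+6m^2-m)q+(m^4-6m^3+2m-1)r\bigr)\\ &\quad\times\bigl((m^5+2m^4-6m^2-m)q+(m^4+6m^3-2m-1)r\bigr),\\ b_4 & = 128m^3(m^4-1)^3(mr-q)(m^2q^2-r^2)\bigl((m^3-3m)q+(3m^2-1)r\bigr). \end{aligned} \] Then, in each of the two cases, all the 16 sums $a_i+b_j$,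 $i=1,\ldots,4$, $j=1,\ldots,4$, are squares of rational numbers (hence squares of integers when $m,q,r$ are integers). *)

(* Defs.v *)
From mathcomp Require Import all_boot all_order all_algebra.

Set Implicit Arguments.
Unset Strict Implicit.
Unset Printing Implicit Defensive.

Import GRing.Theory.
Local Open Scope ring_scope.

(* Quadruples are 4-tuples, so entry i (counted from 1) is [tnth _ (i - 1)]. *)

Definition a_case_i (m q r : rat) : 4.-tuple rat :=
  [tuple
     16 * m ^+ 2 * (m ^+ 4 - 1) ^+ 2
       * ((5 * m ^+ 4 - 2 * m ^+ 2 + 1) * q ^+ 2
          - 2 * (m ^+ 4 - 6 * m ^+ 2 + 1) * q * r
          + (m ^+ 4 - 2 * m ^+ 2 + 5) * r ^+ 2) ^+ 2;
     16 * m ^+ 2 * (m ^+ 4 - 1) ^+ 2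
       * ((5 * m ^+ 4 - 2 * m ^+ 2 + 1) * q ^+ 2
          - (m ^+ 4 - 2 * m ^+ 2 + 5) * r ^+ 2) ^+ 2;
     16 * m ^+ 2 * (m ^+ 4 - 1) ^+ 2
       * ((7 * m ^+ 4 - 2 * m ^+ 2 - 1) * q ^+ 2
          - (2 * m ^+ 4 - 12 * m ^+ 2 + 2) * q * r
          - (m ^+ 4 + 2 * m ^+ 2 - 7) * r ^+ 2) ^+ 2;
     (m ^+ 2 - 1) ^+ 2
       * ((3 * m ^+ 8 + 40 * m ^+ 6 - 26 * m ^+ 4 - 1) * q ^+ 2
          + 2 * (m ^+ 4 - 6 * m ^+ 2 + 1) ^+ 2 * q * r
          - (m ^+ 8 + 26 * m ^+ 4 - 40 * m ^+ 2 - 3) * r ^+ 2) ^+ 2].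

Definition b_case_i (m q r : rat) : 4.-tuple rat :=
  [tuple
     0;
     - 4 * m ^+ 2
       * ((m ^+ 4 + 6 * m ^+ 2 - 3) * q + (m ^+ 4 - 2 * m ^+ 2 + 5) * r)
       * ((3 * m ^+ 4 - 6 * m ^+ 2 - 1) * q - (m ^+ 4 - 2 * m ^+ 2 + 5) * r)
       * ((5 * m ^+ 4 - 2 * m ^+ 2 + 1) * q - (3 * m ^+ 4 - 6 * m ^+ 2 - 1) * r)
       * ((5 * m ^+ 4 - 2 * m ^+ 2 + 1) * q + (m ^+ 4 + 6 * m ^+ 2 - 3) * r);
     - 128 * m ^+ 2 * (m ^+ 4 - 1) ^+ 3 * (q ^+ 2 - r ^+ 2)
       * (3 * m ^+ 2 * q - m ^+ 2 * r - q + 3 * r) * (m ^+ 2 * q + r);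
     16 * (m ^+ 2 + 1) ^+ 2 * (m ^+ 2 - 1) ^+ 3 * (m ^+ 2 * q ^+ 2 - r ^+ 2)
       * ((m ^+ 4 + 6 * m ^+ 3 - 2 * m - 1) * q
          - (m ^+ 4 + 2 * m ^+ 3 - 6 * m - 1) * r)
       * ((m ^+ 4 - 6 * m ^+ 3 + 2 * m - 1) * q
          - (m ^+ 4 - 2 * m ^+ 3 + 6 * m - 1) * r)].

Definition a_case_ii (m q r : rat) : 4.-tuple rat :=
  [tuple
     16 * m ^+ 2 * (m ^+ 4 - 1) ^+ 2
       * ((m ^+ 6 - 2 * m ^+ 4 + 5 * m ^+ 2) * q ^+ 2
          + (2 * m ^+ 5 - 12 * m ^+ 3 + 2 * m) * q * r
          + (5 * m ^+ 4 - 2 * m ^+ 2 + 1) * r ^+ 2) ^+ 2;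
     16 * m ^+ 2 * (m ^+ 4 - 1) ^+ 2
       * ((m ^+ 6 - 2 * m ^+ 4 + 5 * m ^+ 2) * q ^+ 2
          - (5 * m ^+ 4 - 2 * m ^+ 2 + 1) * r ^+ 2) ^+ 2;
     (m ^+ 2 - 1) ^+ 2
       * ((m ^+ 10 + 26 * m ^+ 6 - 40 * m ^+ 4 - 3 * m ^+ 2) * q ^+ 2
          + (2 * m ^+ 9 - 24 * m ^+ 7 + 76 * m ^+ 5 - 24 * m ^+ 3 + 2 * m)
            * q * r
          - (3 * m ^+ 8 + 40 * m ^+ 6 - 26 * m ^+ 4 - 1) * r ^+ 2) ^+ 2;
     16 * m ^+ 2 * (m ^+ 4 - 1) ^+ 2
       * ((m ^+ 6 + 2 * m ^+ 4 - 7 * m ^+ 2) * q ^+ 2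
          - (2 * m ^+ 5 - 12 * m ^+ 3 + 2 * m) * q * r
          - (7 * m ^+ 4 - 2 * m ^+ 2 - 1) * r ^+ 2) ^+ 2].

Definition b_case_ii (m q r : rat) : 4.-tuple rat :=
  [tuple
     0;
     - 4 * m ^+ 2
       * ((m ^+ 5 + 6 * m ^+ 3 - 3 * m) * q - (5 * m ^+ 4 - 2 * m ^+ 2 + 1) * r)
       * ((3 * m ^+ 5 - 6 * m ^+ 3 - m) * q + (5 * m ^+ 4 - 2 * m ^+ 2 + 1) * r)
       * ((m ^+ 5 - 2 * m ^+ 3 + 5 * m) * q + (3 * m ^+ 4 - 6 * m ^+ 2 - 1) * r)
       * ((m ^+ 5 - 2 * m ^+ 3 + 5 * m) * q - (m ^+ 4 + 6 * m ^+ 2 - 3) * r);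
     - 16 * m ^+ 2 * (m ^+ 2 + 1) ^+ 2 * (m ^+ 2 - 1) ^+ 3 * (q ^+ 2 - r ^+ 2)
       * ((m ^+ 5 - 2 * m ^+ 4 + 6 * m ^+ 2 - m) * q
          + (m ^+ 4 - 6 * m ^+ 3 + 2 * m - 1) * r)
       * ((m ^+ 5 + 2 * m ^+ 4 - 6 * m ^+ 2 - m) * q
          + (m ^+ 4 + 6 * m ^+ 3 - 2 * m - 1) * r);
     128 * m ^+ 3 * (m ^+ 4 - 1) ^+ 3 * (m * r - q)
       * (m ^+ 2 * q ^+ 2 - r ^+ 2)
       * ((m ^+ 3 - 3 * m) * q + (3 * m ^+ 2 - 1) * r)].

(* Main.v *)
Require Import Defs.
From mathcomp Require Import all_boot all_order all_algebra.
From mathcomp Require Import ring.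
Import GRing.Theory Num.Theory.
Local Open Scope ring_scope.

(** In case (i) each sum a_i + b_j is the square of a polynomial in m, q, r with
    integer coefficients.  Case (ii) is case (i) at (m, r, - m q), with the last
    two entries of each quadruple exchanged. *)

(* Entry (i, j) was found by extracting a polynomial square root of a_i + b_j. *)
Definition root_case_i {R : nzRingType} (m q r : R) : 4.-tuple (4.-tuple R) :=
  [tuple
    [tuple 4 * m * (m ^+ 2 - 1) * (m ^+ 2 + 1) * ((5 * m ^+ 4 - 2 * m ^+ 2
             + 1) * q ^+ 2 - (2 * m ^+ 4 - 12 * m ^+ 2 + 2) * q * r + (m ^+ 4
             - 2 * m ^+ 2 + 5) * r ^+ 2);
           2 * m * ((5 * m ^+ 8 - 32 * m ^+ 6 + 18 * m ^+ 4 - 8 * m ^+ 2 +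
             1) * q ^+ 2 - (10 * m ^+ 8 - 24 * m ^+ 6 + 60 * m ^+ 4 - 24 * m
             ^+ 2 + 10) * q * r + (m ^+ 8 - 8 * m ^+ 6 + 18 * m ^+ 4 - 32 * m
             ^+ 2 + 5) * r ^+ 2);
           4 * m * (m ^+ 2 - 1) * (m ^+ 2 + 1) * ((m ^+ 4 - 6 * m ^+ 2 + 1)
             * q ^+ 2 - (6 * m ^+ 4 - 4 * m ^+ 2 + 6) * q * r + (m ^+ 4 - 6 *
             m ^+ 2 + 1) * r ^+ 2);
           4 * (m ^+ 2 - 1) * (m ^+ 2 + 1) * ((m ^+ 6 - 6 * m ^+ 4 + m ^+
             2) * q ^+ 2 - (m ^+ 6 + 3 * m ^+ 4 + 3 * m ^+ 2 + 1) * q * r +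
             (m ^+ 4 - 6 * m ^+ 2 + 1) * r ^+ 2)];
    [tuple 4 * m * (m ^+ 2 - 1) * (m ^+ 2 + 1) * ((5 * m ^+ 4 - 2 * m ^+ 2
             + 1) * q ^+ 2 - (m ^+ 4 - 2 * m ^+ 2 + 5) * r ^+ 2);
           2 * m * ((5 * m ^+ 8 - 32 * m ^+ 6 + 18 * m ^+ 4 - 8 * m ^+ 2 +
             1) * q ^+ 2 - (2 * m ^+ 8 - 24 * m ^+ 6 + 76 * m ^+ 4 - 24 * m
             ^+ 2 + 2) * q * r + (m ^+ 8 - 8 * m ^+ 6 + 18 * m ^+ 4 - 32 * m
             ^+ 2 + 5) * r ^+ 2);
           4 * m * (m ^+ 2 - 1) * (m ^+ 2 + 1) * ((m ^+ 4 - 6 * m ^+ 2 + 1)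
             * q ^+ 2 + (4 * m ^+ 4 - 4) * q * r - (m ^+ 4 - 6 * m ^+ 2 + 1)
             * r ^+ 2);
           4 * (m ^+ 2 - 1) * (m ^+ 2 + 1) * ((m ^+ 6 - 6 * m ^+ 4 + m ^+
             2) * q ^+ 2 - (m ^+ 6 - 7 * m ^+ 4 + 7 * m ^+ 2 - 1) * q * r -
             (m ^+ 4 - 6 * m ^+ 2 + 1) * r ^+ 2)];
    [tuple 4 * m * (m ^+ 2 - 1) * (m ^+ 2 + 1) * ((7 * m ^+ 4 - 2 * m ^+ 2
             - 1) * q ^+ 2 - (2 * m ^+ 4 - 12 * m ^+ 2 + 2) * q * r - (m ^+ 4
             + 2 * m ^+ 2 - 7) * r ^+ 2);
           2 * m * ((11 * m ^+ 8 - 16 * m ^+ 6 + 30 * m ^+ 4 - 8 * m ^+ 2 -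
             1) * q ^+ 2 - (6 * m ^+ 8 - 40 * m ^+ 6 + 36 * m ^+ 4 - 40 * m
             ^+ 2 + 6) * q * r - (m ^+ 8 + 8 * m ^+ 6 - 30 * m ^+ 4 + 16 * m
             ^+ 2 - 11) * r ^+ 2);
           4 * m * (m ^+ 2 - 1) * (m ^+ 2 + 1) * ((5 * m ^+ 4 - 2 * m ^+ 2
             + 1) * q ^+ 2 - (2 * m ^+ 4 - 12 * m ^+ 2 + 2) * q * r + (m ^+ 4
             - 2 * m ^+ 2 + 5) * r ^+ 2);
           4 * (m ^+ 2 - 1) * (m ^+ 2 + 1) * ((m ^+ 6 + 6 * m ^+ 4 - 3 * m
             ^+ 2) * q ^+ 2 - (m ^+ 6 - 5 * m ^+ 4 - 5 * m ^+ 2 + 1) * q * r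
             - (3 * m ^+ 4 - 6 * m ^+ 2 - 1) * r ^+ 2)];
    [tuple (m ^+ 2 - 1) * ((3 * m ^+ 8 + 40 * m ^+ 6 - 26 * m ^+ 4 - 1) * q
             ^+ 2 + (2 * m ^+ 8 - 24 * m ^+ 6 + 76 * m ^+ 4 - 24 * m ^+ 2 +
             2) * q * r - (m ^+ 8 + 26 * m ^+ 4 - 40 * m ^+ 2 - 3) * r ^+ 2);
           (m ^+ 2 + 1) ^+ 2 * ((3 * m ^+ 6 - 19 * m ^+ 4 + 9 * m ^+ 2 - 1)
             * q ^+ 2 + (2 * m ^+ 6 - 10 * m ^+ 4 - 10 * m ^+ 2 + 2) * q * r
             - (m ^+ 6 - 9 * m ^+ 4 + 19 * m ^+ 2 - 3) * r ^+ 2);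
           (m ^+ 2 - 1) * ((3 * m ^+ 8 - 24 * m ^+ 6 + 38 * m ^+ 4 - 1) * q
             ^+ 2 + (2 * m ^+ 8 + 40 * m ^+ 6 - 52 * m ^+ 4 + 40 * m ^+ 2 +
             2) * q * r - (m ^+ 8 - 38 * m ^+ 4 + 24 * m ^+ 2 - 3) * r ^+ 2);
           (m ^+ 2 - 1) * ((5 * m ^+ 8 - 32 * m ^+ 6 + 18 * m ^+ 4 - 8 * m
             ^+ 2 + 1) * q ^+ 2 - (2 * m ^+ 8 - 24 * m ^+ 6 + 76 * m ^+ 4 -
             24 * m ^+ 2 + 2) * q * r + (m ^+ 8 - 8 * m ^+ 6 + 18 * m ^+ 4 -
             32 * m ^+ 2 + 5) * r ^+ 2)]].

(** Each of the 16 index pairs is a polynomial identity in [m], [q], [r]. For the first column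
    [b_1 = 0], so the root is the base of the square [a_i]. *)
Lemma add_case_iE (m q r : rat) (i j : 'I_4) :
  tnth (a_case_i m q r) i + tnth (b_case_i m q r) j
  = tnth (tnth (root_case_i m q r) i) j ^+ 2.
Proof.
case: i => [[|[|[|[|i]]]] hi] //; case: j => [[|[|[|[|j]]]] hj] //;
  (* The default values, 0 for an entry and a zero row for a row, are never reached; they only turn
     [tnth] into [nth], which computes. *)
  rewrite !(tnth_nth 0) !(tnth_nth [tuple 0; 0; 0; 0]) /=; ring.
Qed.

(** The literals are elements of the ring ['I_4], and indices count from 0: the third and fourth
    entries are 2 and 3. The lookup reduces like the other tuples. *)
Definition swap_last2 (i : 'I_4) : 'I_4 := tnth [tuple 0; 1; 3; 2] i.

(** The substitution sends [q ^+ 2], [q * r], [r ^+ 2] to [r ^+ 2], [- m * q * r],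
    [m ^+ 2 * q ^+ 2]. The quadratic forms then agree up to a sign, which the outer square
    removes. *)
Lemma a_case_iiE (m q r : rat) (i : 'I_4) :
  tnth (a_case_ii m q r) i = tnth (a_case_i m r (- (m * q))) (swap_last2 i).
Proof.
by case: i => [[|[|[|[|i]]]] hi] //;
  rewrite /swap_last2 !(tnth_nth 0) /=; ring.
Qed.

(** The linear factors correspond up to order, sign and powers of [m]. For instance [m ^+ 2 * q + r]
    becomes [m * (m * r - q)], whence [m ^+ 3] in the last entry. *)
Lemma b_case_iiE (m q r : rat) (i : 'I_4) :
  tnth (b_case_ii m q r) i = tnth (b_case_i m r (- (m * q))) (swap_last2 i).
Proof.
by case: i => [[|[|[|[|i]]]] hi] //;
  rewrite /swap_last2 !(tnth_nth 0) /=; ring.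
Qed.

Ltac solve_rpred :=
  repeat match goal with
  | |- is_true (_ + _ \in _) => apply: rpredD
  | |- is_true (- _ \in _) => rewrite rpredN
  | |- is_true (_ * _ \in _) => apply: rpredM
  | |- is_true (_ ^+ _ \in _) => apply: rpredX
  | |- is_true (_%:R \in _) => apply: rpred_nat
  | |- is_true (1 \in _) => apply: rpred1
  | _ => assumption
  end.

(** Integer coefficients keep the roots in any subring containing [m], [q], [r]. With [Num.int] as
    the subring, this gives integral roots directly. *)
Lemma root_case_i_rpred {R : nzRingType} {S : subringClosed R} {m q r : R}
    (i j : 'I_4) :
  m \in S -> q \in S -> r \in S -> tnth (tnth (root_case_i m q r) i) j \in S.
Proof.
move=> hm hq hr.
case: i => [[|[|[|[|i]]]] hi] //; case: j => [[|[|[|[|j]]]] hj] //;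
  rewrite (tnth_nth 0) (tnth_nth [tuple 0; 0; 0; 0]) /=; solve_rpred.
Qed.

Theorem theorem4 (m q r : rat) (a b : 4.-tuple rat)
    (hab : (a = a_case_i m q r /\ b = b_case_i m q r) \/
           (a = a_case_ii m q r /\ b = b_case_ii m q r)) :
  (forall i j : 'I_4, exists s : rat, tnth a i + tnth b j = s ^+ 2) /\
  (m \is a Num.int -> q \is a Num.int -> r \is a Num.int ->
   forall i j : 'I_4, exists s : int, tnth a i + tnth b j = s%:~R ^+ 2).
Proof.
case: hab => [[-> ->]|[-> ->]]; split.
- by move=> i j; rewrite add_case_iE; eexists.
- move=> hm hq hr i j; rewrite add_case_iE.
  by have /intrP[s ->] := root_case_i_rpred i j hm hq hr; exists s.
- by move=> i j; rewrite a_case_iiE b_case_iiE add_case_iE; eexists.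
- move=> hm hq hr i j; rewrite a_case_iiE b_case_iiE add_case_iE.
  (* The roots are now taken at [(m, r, - (m * q))], so the new third argument must be integral
     too. *)
  have hmq : - (m * q) \is a Num.int by rewrite rpredN rpredM.
  by have /intrP[s ->] := root_case_i_rpred (swap_last2 i) (swap_last2 j) hm hr hmq;
    exists s.
Qed.
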